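(* Let $K$ be a long knot given by an oriented diagram with $n$ crossings, numbered $1,\dots,n$ in any order, and with its $n$ bounded regions numbered $1,\dots,n$ in any order. Let $\beta(K)(x)=\det\big(I+T(I-X^{-S})\big)$, and let $\Delta(K)(x)=\det A(K)$ be the determinant of the Alexander matrix of the diagram (both as defined in the context). Then $$\beta(K)(x)=\pm x^{-l}\,\Delta(K)(x)$$ for some choice of sign, where $l$ is the number of crossings $j\in\{1,\dots,n\}$ for which $S(j)=+1$.
   Context: A long knot diagram is a planar diagram, with over/under information at each crossing (transverse double point), of an oriented line properly embedded in space and straight near both ends. With $n$ crossings, its arcs divide the oriented plane into $n+2$ regions, exactly two of which are unbounded and $n$ of which are bounded. Crossings and bounded regions are each numbered $1,\dots,n$ arbitrarily. Throughout, $x$ is an indeterminate, and identities hold in $\mathbb{Z}[x,x^{-1}]$. Imagine an ant walking along the whole knot in the direction of the orientation. It passes each crossing exactly twice, once on the over strand and once on the under strand. Span: for $1\le i\le n$, $Sp(i)$ is the oriented open segment of the knot between the two times the ant passes through crossing $i$. Matrix $T$: the $n\times n$ matrix with $T_{ij}=1$ if the ant crosses under crossing $j$ at any point as it walks along $Sp(i)$, and $T_{ij}=0$ otherwise. (Since $Sp(i)$ is open, $T_{ii}=0$.) Signs: $\sigma_i\in\{\pm1\}$ is the usual sign of crossing $i$ (a crossing is positive if, when the over strand runs from lower left to upper right, the under strand runs from lower right to upper left). Set $d_i=+1$ if the ant goes over crossing $i$ before it goes under crossing $i$, and $d_i=-1$ otherwise. Set $S(i)=\sigma_i d_i$. $X^{-S}$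 is the $n\times n$ diagonal matrix with diagonal entries $x^{-S(i)}$. $I$ is the identity matrix. Alexander matrix $A(K)$: mark the four corners at each crossing as follows. Proceeding along the over strand in the direction of its orientation, the two corners on the right are marked first $-x$ (before the under strand), then $x$ (after the under strand); the two corners on the left are marked first $1$ (before the under strand), then $-1$ (after the under strand). $A(K)$ is the $n\times n$ matrix (rows indexed by crossings, columns by bounded regions) whose $(i,j)$ entry is the marking of crossing $i$ lying in region $j$, and $0$ if crossing $i$ and region $j$ do not abut; if several corners of crossing $i$ lie in the same region $j$, the entry is the sum of the corresponding markings. *)

(* Defs.v *)
From mathcomp Require Import all_boot all_order all_algebra.

Set Implicit Arguments.
Unset Strict Implicit.
Unset Printing Implicit Defensive.

Import Order.TTheory GRing.Theory Num.Theory.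
Local Open Scope ring_scope.

(* A long knot diagram is represented by its combinatorial map (a signed
   Gauss code together with the planarity condition [planar] below), up to
   orientation-preserving isotopy of the plane.  The ant meets 2n passages, at
   the times 0, ..., 2n-1; passage (i, true) is the one over crossing i and
   (i, false) the one under it.  The local planar picture at crossing i is
   fixed by the direction in which the under strand traverses the (oriented)
   over strand. *)
Record long_code (n : nat) := LongCode {
  passage : 'I_n * bool -> 'I_n.*2;
  passage_inj : injective passage;
  right_to_left : 'I_n -> bool
}.

Definition over_time n (K : long_code n) (i : 'I_n) : 'I_n.*2 :=
  passage K (i, true).
Definition under_time n (K : long_code n) (i : 'I_n) : 'I_n.*2 :=
  passage K (i, false).

(* Arc k arrives at passage k and leaves from passage k.-1, so that arc 0 comes
   from infinity and arc 2n goes to infinity. *)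
Definition arc (n : nat) := 'I_(n.*2).+1.
Definition arc_in n (t : 'I_n.*2) : arc n := widen_ord (leqnSn _) t.
Definition arc_out n (t : 'I_n.*2) : arc n := lift ord0 t.

(* A side of an arc: true is the left side, false the right side, with respect
   to the orientation of the knot. *)
Definition arc_side (n : nat) := (arc n * bool)%type.

(* The corner (s, a) of crossing i lies on side s of the over strand (true:
   left) and, along the over strand, after (a = true) or before (a = false) the
   under strand.  It is bounded by one half of the over strand, seen from its
   side s, and by one half of the under strand.  If the under strand runs from
   right to left then its outgoing half is on the left of the over strand and
   the corners after it are on its right; otherwise it is the opposite. *)
Definition corner_over n (K : long_code n) (i : 'I_n) (s a : bool) :
    arc_side n :=
  ((if a then arc_out (over_time K i) else arc_in (over_time K i)), s).
Definition corner_under n (K : long_code n) (i : 'I_n) (s a : bool) :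
    arc_side n :=
  ((if s == right_to_left K i then arc_out (under_time K i)
    else arc_in (under_time K i)),
   a != right_to_left K i).

(* Two arc sides that bound a common corner border the same region; so do the
   left (resp. right) sides of the two unbounded arcs, far away. *)
Definition corner_adj n (K : long_code n) : rel (arc_side n) := fun u v =>
  [exists i : 'I_n, exists s : bool, exists a : bool,
     (u == corner_over K i s a) && (v == corner_under K i s a)]
  || [exists s : bool, (u == (ord0, s)) && (v == (ord_max, s))].

Definition side_adj n (K : long_code n) : rel (arc_side n) := fun u v =>
  corner_adj K u v || corner_adj K v u.

(* A region of the complement of the diagram is given by the set of the arc
   sides on its boundary. *)
Definition region_of n (K : long_code n) (u : arc_side n) :
    {set arc_side n} := [set v | connect (side_adj K) u v].

Definition regions n (K : long_code n) : {set {set arc_side n}} :=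
  [set region_of K u | u : arc_side n].

Definition unbounded_regions n (K : long_code n) : {set {set arc_side n}} :=
  [set region_of K (ord0, s) | s : bool].

Definition bounded_regions n (K : long_code n) : {set {set arc_side n}} :=
  regions K :\: unbounded_regions K.

(* Euler's formula V + F = E + 2 on the sphere, the vertices being the n
   crossings and the point at infinity, and the edges the 2n+1 arcs (the map is
   connected, since the arcs form a single path).  It says that there are n+2
   regions, and characterises the codes of diagrams drawn in the plane. *)
Definition planar n (K : long_code n) : bool :=
  (n.+1 + #|regions K| == #|{: arc n}| + 2)%N.

Record long_diagram (n : nat) := LongDiagram {
  code :> long_code n;
  code_planar : planar code
}.

(* Z[x, x^-1] is regarded as a subring of the field of fractions of Z[x]. *)
Definition laurent_frac := {fraction {poly int}}.
Definition xvar : laurent_frac := FracField.tofrac ('X : {poly int}).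

(* Sp(i) is the open segment between the two passages at crossing i. *)
Definition in_span n (K : long_code n) (i : 'I_n) (t : 'I_n.*2) : bool :=
  (minn (over_time K i) (under_time K i) < t
     < maxn (over_time K i) (under_time K i))%N.

Definition span_mx n (K : long_code n) : 'M[laurent_frac]_n :=
  \matrix_(i, j) (in_span K i (under_time K j))%:R.

Definition sigma n (K : long_code n) (i : 'I_n) : int :=
  if right_to_left K i then 1 else -1.
Definition dsign n (K : long_code n) (i : 'I_n) : int :=
  if (over_time K i < under_time K i)%N then 1 else -1.
Definition sgnS n (K : long_code n) (i : 'I_n) : int := sigma K i * dsign K i.

Definition XmS_mx n (K : long_code n) : 'M[laurent_frac]_n :=
  diag_mx (\row_i xvar ^ (- sgnS K i)).

Definition beta n (K : long_code n) : laurent_frac :=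
  \det (1%:M + span_mx K *m (1%:M - XmS_mx K)).

Definition marking (s a : bool) : laurent_frac :=
  if s then (if a then -1 else 1) else (if a then xvar else - xvar).

(* rho numbers the bounded regions.  Both arc sides of a corner are in the same
   region, so corner_over can stand for the corner. *)
Definition alexander_matrix n (K : long_code n)
    (rho : 'I_n -> {set arc_side n}) : 'M[laurent_frac]_n :=
  \matrix_(i, j)
    \sum_(s : bool) \sum_(a : bool | corner_over K i s a \in rho j) marking s a.

Definition Delta n (K : long_code n) (rho : 'I_n -> {set arc_side n}) :
    laurent_frac := \det (alexander_matrix K rho).

Definition num_S_pos n (K : long_code n) : nat := #|[set j | sgnS K j == 1]|.

(* Main.v *)
Require Import Defs.
From mathcomp Require Import all_boot all_order all_algebra.
From mathcomp Require Import ring zify.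
Import Order.TTheory GRing.Theory Num.Theory.
Local Open Scope ring_scope.

(* Given a function on the regions that vanishes on the unbounded ones, let the
   flow through an arc be the value on its left minus the value on its right.
   The flow is conserved at each crossing, so its jump along the over strand is
   the opposite of its jump along the under strand; hence the flow through any
   arc is a signed sum of the jumps at the crossings that have exactly one
   passage before it, i.e. whose span contains it.  The row of A(K) at a
   crossing is a combination of the flows before and after the under passage.
   Writing it in terms of jumps gives
     A(K) = diag (x^[S = 1] d) (I + T (I - X^-S))^T diag (d) H
   where H is the integer matrix mapping functions on bounded regions to jumps.
   A function without jumps is constant, hence zero, over any field, so det H
   is nonzero modulo every prime and equals 1 or -1. *)

(** A prime factor of the determinant would make it vanish modulo that prime; the prime 2 excludes a
    zero determinant. *)
Lemma unit_int_det_mod n (A : 'M[int]_n) :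
  (forall p, prime p -> \det (map_mx (intr : int -> 'F_p) A) != 0) ->
  \det A = 1 \/ \det A = -1.
Proof.
move=> detA.
have detA0 : \det A != 0.
  by apply: contraNneq (detA 2%N isT) => A0; rewrite det_map_mx A0 rmorph0.
have abs1 : `|\det A|%N = 1%N.
  apply/eqP; rewrite -[_ == _]negbK; apply/negP => abs_neq1.
  have [p p_pr /dvdnP[k defk]] : exists2 p, prime p & (p %| `|\det A|)%N.
    exists (pdiv `|\det A|); rewrite ?pdiv_dvd ?pdiv_prime //.
    by rewrite ltn_neqAle eq_sym abs_neq1 absz_gt0.
  have /negP[] := detA p p_pr; rewrite det_map_mx (intEsign (\det A)) defk.
  by rewrite rmorphM /= -pmulrn natrM (pchar_Fp_0 p_pr) !mulr0.
by case: (\det A) abs1 => [m|m] /=; [move->; left | move=> [->]; right].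
Qed.

(* o s and w s are the values on side s of the outgoing and of the incoming
   half of the under strand, r is right_to_left and d tells whether the over
   passage comes first. *)
Lemma marked_corners (F : fieldType) (x : F) (r d : bool) (o w : bool -> F)
    (sg := (if r then 1 else -1) * (if d then 1 else -1) : int) :
  x != 0 ->
  (if r then o false * -1 + o true * 1 + (w false * x + w true * - x)
   else w true * -1 + w false * 1 + (o true * x + o false * - x)) =
  x ^+ (sg == 1) * (if d then 1 else -1 : int)%:~R *
  ((if d then 1 else -1 : int)%:~R *
     (o true - o false - (w true - w false)) +
   (1 - x ^ (- sg)) *
     - (if d then o true - o false else w true - w false)).
Proof.
move=> x_neq0; rewrite /sg; case: r d {sg} => [] [] /=;
  rewrite ?mulrN ?mulr1 ?opprK ?expr1z ?exprN1 //=; by field.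
Qed.

Section Diagram.

Context {n : nat} (K : long_code n).

Lemma arc_ind (P : Defs.arc n -> Prop) :
  P ord0 -> (forall t, P (arc_in t) -> P (arc_out t)) -> forall k, P k.
Proof.
move=> P0 PS [m lt_m]; elim: m lt_m => [|m IHm] lt_m.
  by rewrite [Ordinal _](_ : _ = ord0) //; apply: val_inj.
have -> : Ordinal lt_m = arc_out (Ordinal (ltnSE lt_m)) by apply: val_inj.
by apply/PS; have := IHm (ltnW lt_m); congr (P _); apply: val_inj.
Qed.

Lemma passage_bij : bijective (passage K).
Proof.
apply: inj_card_bij (@passage_inj _ K) _.
by rewrite card_prod card_bool !card_ord muln2.
Qed.

(** * Flows and jumps of a function on regions *)

Section Potential.

Context {R : comPzRingType} (phi : arc_side n -> R).
Context (phi_adj : forall u v, corner_adj K u v -> phi u = phi v).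
Context (phi0 : forall s, phi (ord0, s) = 0).

Definition flow (k : Defs.arc n) : R := phi (k, true) - phi (k, false).

Definition jump (i : 'I_n) : R :=
  flow (arc_out (under_time K i)) - flow (arc_in (under_time K i)).

Lemma phi_corner i s a : phi (corner_over K i s a) = phi (corner_under K i s a).
Proof.
apply: phi_adj; apply/orP; left.
by apply/existsP; exists i; apply/existsP; exists s; apply/existsP; exists a;
  rewrite !eqxx.
Qed.

(** Both jumps are, with opposite signs, the same alternating sum of [phi] over the four corners. *)
Lemma flow_over i :
  flow (arc_out (over_time K i)) - flow (arc_in (over_time K i)) = - jump i.
Proof.
have LA := phi_corner i true true; have LB := phi_corner i true false.
have RA := phi_corner i false true; have RB := phi_corner i false false.
rewrite /jump /flow; move: LA LB RA RB; rewrite /corner_over /corner_under.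
by case: right_to_left => /= -> -> -> ->; ring.
Qed.

Lemma sum_passage (V : nmodType) (P : pred 'I_n.*2) (F : 'I_n.*2 -> V) :
  \sum_(t | P t) F t =
  \sum_i ((if P (over_time K i) then F (over_time K i) else 0) +
          (if P (under_time K i) then F (under_time K i) else 0)).
Proof.
rewrite (reindex (passage K)) /=; last apply/onW_bij/passage_bij.
pose G i b := if P (passage K (i, b)) then F (passage K (i, b)) else 0.
transitivity (\sum_i \sum_b G i b).
  by rewrite pair_bigA big_mkcond; apply: eq_bigr => [[i b]] _.
by apply: eq_bigr => i _; rewrite big_bool.
Qed.

Lemma flow_sum (t : 'I_n.*2) :
  flow (arc_in t) = \sum_(s : 'I_n.*2 | (s < t)%N)
    (flow (arc_out s) - flow (arc_in s)).
Proof.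
(* [inord] makes the flow a function of natural numbers, for telescoping; all indices used are
   within its range. *)
have -> : flow (arc_in t) = flow (inord t).
  by congr flow; apply: val_inj; rewrite /= inordK // ltnW // ltnS ltn_ord.
transitivity (\sum_(0 <= s < t) (flow (inord s.+1) - flow (inord s))).
  rewrite telescope_sumr //.
  have -> : inord 0 = ord0 :> Defs.arc n by apply: val_inj; rewrite /= inordK.
  by rewrite {3}/flow !phi0 !subr0.
rewrite big_mkord (big_ord_widen _ (fun s => flow (inord s.+1) - flow (inord s))
  (ltnW (ltn_ord t))).
apply: eq_bigr => s _; congr (flow _ - flow _); apply: val_inj => /=;
  by rewrite inordK // ltnS // ltnW.
Qed.

(** A crossing passed twice before the under passage at [i] cancels; one passed once leaves its
    jump, signed by which passage came first. The open span of [i] omits [i] itself: when its over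
    passage comes first, its term is removed by taking the outgoing arc. *)
Lemma flow_span i :
  \sum_k (in_span K k (under_time K i))%:R * (dsign K k)%:~R * jump k =
  - flow (if (over_time K i < under_time K i)%N then arc_out (under_time K i)
          else arc_in (under_time K i)).
Proof.
have -> : flow (if (over_time K i < under_time K i)%N
                then arc_out (under_time K i) else arc_in (under_time K i)) =
    flow (arc_in (under_time K i)) +
    (if (over_time K i < under_time K i)%N then jump i else 0).
  by case: ifP => _; rewrite ?addr0 // /jump addrC subrK.
rewrite flow_sum sum_passage opprD -sumrN.
rewrite (bigD1 i) //= [X in _ = X - _](bigD1 i) //= ltnn.
have -> : in_span K i (under_time K i) = false.
  by rewrite /in_span /minn /maxn; case: ifP => _; rewrite ltnn ?andbF.
rewrite !mul0r add0r addr0 flow_over; set self := (X in _ = X + _ - _).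
have -> : self = if (over_time K i < under_time K i)%N then jump i else 0.
  by rewrite /self; case: ifP => _; rewrite ?opprK ?oppr0.
rewrite addrAC subrr add0r; apply: eq_bigr => k neq_ki.
rewrite flow_over -/(jump k) /in_span /dsign.
(* The under passage at [i] coincides with neither passage at [k], so the order of these three times
   decides every term. *)
have neq_t b b' : passage K (k, b) != passage K (i, b') :> nat.
  rewrite (inj_eq val_inj) (inj_eq (@passage_inj _ K)) xpair_eqE.
  by rewrite (negPf neq_ki).
have := neq_t true false; have := neq_t false false.
rewrite /over_time /under_time; move: (jump k) => h.
move: (nat_of_ord _) (nat_of_ord _) (nat_of_ord _) => t u v.
rewrite /minn /maxn; case: (ltnP t v) => tv; case: (ltngtP t u) => tu //;
  by case: (ltngtP v u) => vu //= _ _; first [ring | lia].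
Qed.

(** Without jumps no arc carries flow, so [phi] agrees on both sides of each arc, and the value 0 on
    the initial arc spreads through the corners. *)
Lemma phi_eq0 : (forall i, jump i = 0) -> forall u, phi u = 0.
Proof.
move=> jump0.
have flow0 k : flow k = 0.
  elim/arc_ind: k => [|t flow_t]; first by rewrite /flow !phi0 subrr.
  rewrite -[RHS]flow_t; apply/eqP; rewrite -subr_eq0.
  have [inv _ passageK] := passage_bij.
  rewrite -[t]passageK; case: (inv t) => i [].
    by rewrite flow_over jump0 oppr0.
  by rewrite -/(under_time K i) -/(jump i) jump0.
have phi_side k s s' : phi (k, s) = phi (k, s').
  by have /eqP := flow0 k; rewrite subr_eq0 => /eqP; case: s s' => [] [].
have under_over i a s a' s' :
    phi ((if a then arc_out (under_time K i) else arc_in (under_time K i)), s) =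
    phi ((if a' then arc_out (over_time K i) else arc_in (over_time K i)), s').
  (* This is the side of the over strand on which half [a] of the under strand lies. *)
  rewrite (phi_side _ s' (a == right_to_left K i)).
  have := phi_corner i (a == right_to_left K i) a'.
  rewrite /corner_over /corner_under => ->.
  by rewrite (phi_side _ s (a' != right_to_left K i)); case: a; case: ifP;
    case: (right_to_left K i).
case=> k s; rewrite (phi_side _ s true).
elim/arc_ind: k => [|t phi_t]; first exact: phi0.
rewrite -[RHS]phi_t; have [inv _ passageK] := passage_bij.
(* Both halves of one strand are compared with a common half of the other. *)
rewrite -[t]passageK; case: (inv t) => i [].
  by rewrite -(under_over i true true true) -(under_over i true true false).
by rewrite (under_over i true _ true true) (under_over i false _ true true).
Qed.

End Potential.

(** By [flow_span], the sum with T collapses to the flow on one half of the under strand at [i], so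
    only the values beside its two halves remain and [marked_corners] applies. *)
Lemma alexander_row (phi : arc_side n -> laurent_frac) i :
  (forall u v, corner_adj K u v -> phi u = phi v) ->
  (forall s, phi (ord0, s) = 0) ->
  \sum_(s : bool) \sum_(a : bool) phi (corner_over K i s a) * marking s a =
  xvar ^+ (sgnS K i == 1) * (dsign K i)%:~R *
  \sum_k (1%:M + span_mx K *m (1%:M - XmS_mx K)) k i *
         ((dsign K k)%:~R * jump phi k).
Proof.
move=> phi_adj phi0.
have x_neq0 : xvar != 0 by rewrite tofrac_eq0 polyX_eq0.
have -> : \sum_k (1%:M + span_mx K *m (1%:M - XmS_mx K)) k i *
    ((dsign K k)%:~R * jump phi k) =
    (dsign K i)%:~R * jump phi i + (1 - xvar ^ (- sgnS K i)) *
      \sum_k (in_span K k (under_time K i))%:R * (dsign K k)%:~R * jump phi k.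
  have entry k : (1%:M + span_mx K *m (1%:M - XmS_mx K)) k i =
      (k == i)%:R + (in_span K k (under_time K i))%:R
                    * (1 - xvar ^ (- sgnS K i)).
    rewrite /XmS_mx mulmxBr mulmx1 mul_mx_diag !mxE; ring.
  under eq_bigr do rewrite entry mulrDl.
  rewrite big_split /= mulr_sumr; congr (_ + _).
    rewrite (bigD1 i) //= eqxx mul1r big1 ?addr0 // => k /negPf->.
    by rewrite mul0r.
  by apply: eq_bigr => k _; ring.
rewrite flow_span // (fun_if (flow phi)).
pose o s := phi (arc_out (under_time K i), s).
pose w s := phi (arc_in (under_time K i), s).
transitivity (if right_to_left K i
    then o false * -1 + o true * 1 + (w false * xvar + w true * - xvar)
    else w true * -1 + w false * 1 + (o true * xvar + o false * - xvar)).
  rewrite !big_bool !phi_corner // /corner_under.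
  by case: right_to_left.
exact: marked_corners.
Qed.

(** * The jump matrix of the bounded regions *)

Section Regions.

Context {rho : 'I_n -> {set arc_side n}} (rho_inj : injective rho).
Context (rho_regions : [set rho j | j : 'I_n] = bounded_regions K).

Lemma mem_region {u v : arc_side n} {j} :
  u \in rho j -> (v \in rho j) = connect (side_adj K) u v.
Proof.
have : rho j \in bounded_regions K by rewrite -rho_regions imset_f.
rewrite inE => /andP[_ /imsetP[w _ ->]].
have sym : connect_sym (side_adj K).
  by apply: sym_connect_sym => ? ?; rewrite /side_adj orbC.
by rewrite !inE => /(same_connect sym) ->.
Qed.

Lemma rho_nonempty j : exists u, u \in rho j.
Proof.
have : rho j \in bounded_regions K by rewrite -rho_regions imset_f.
rewrite inE => /andP[_ /imsetP[w _ ->]]; exists w.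
by rewrite inE connect0.
Qed.

Lemma rho_disjoint {u j k} : u \in rho j -> u \in rho k -> j = k.
Proof.
move=> uj uk; apply/rho_inj/setP => v.
by rewrite (mem_region uj) (mem_region uk).
Qed.

Lemma rho_adj {u v j} : corner_adj K u v -> (u \in rho j) = (v \in rho j).
Proof.
move=> adj_uv; apply/idP/idP => uj; rewrite (mem_region uj);
  by apply: connect1; rewrite /side_adj adj_uv ?orbT.
Qed.

Lemma rho_ord0 s j : ((ord0, s) \in rho j) = false.
Proof.
apply/negP => sj; have : rho j \in bounded_regions K.
  by rewrite -rho_regions imset_f.
rewrite inE => /andP[/negP unb _]; apply: unb; apply/imsetP; exists s => //.
by apply/setP => v; rewrite (mem_region sj) inE.
Qed.

Definition rho_ind (R : comPzRingType) j (u : arc_side n) : R :=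
  (u \in rho j)%:R.

(** The matrix H, over any ring so that it can be reduced modulo primes. *)
Definition jump_mx (R : comPzRingType) : 'M[R]_n :=
  \matrix_(i, j) jump (rho_ind R j) i.

Lemma map_jump_mx (R S : comPzRingType) (f : {rmorphism R -> S}) :
  map_mx f (jump_mx R) = jump_mx S.
Proof.
by apply/matrixP => i j; rewrite !mxE /jump /flow /rho_ind !rmorphB !rmorph_nat.
Qed.

(** A kernel vector gives a value to each bounded region. Extended by 0 it has no jumps, so it
    vanishes by [phi_eq0]; a side of region [j] lies in no other region and so recovers the entry at
    [j]. *)
Lemma det_jump_mx_neq0 (F : fieldType) : \det (jump_mx F) != 0.
Proof.
rewrite -det_tr; apply/det0P => -[v /negP v_neq0 vH0]; apply: v_neq0.
pose phi u := \sum_j v 0 j * rho_ind F j u.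
have phi_jump i : jump phi i = 0.
  transitivity ((v *m (jump_mx F)^T) 0 i); last by rewrite vH0 mxE.
  rewrite mxE /jump /flow /phi -!sumrB; apply: eq_bigr => j _.
  by rewrite !mxE !mulrBr.
have phi0 : forall u, phi u = 0.
  apply: phi_eq0 phi_jump => [u v' adj_uv|s].
    by apply: eq_bigr => j _; rewrite /rho_ind (rho_adj adj_uv).
  by apply: big1 => j _; rewrite /rho_ind rho_ord0 mulr0.
apply/eqP/rowP => j; rewrite mxE; have [u uj] := rho_nonempty j.
rewrite -[RHS](phi0 u) /phi (bigD1 j) //= /rho_ind uj mulr1 big1 ?addr0 // => k.
by move=> neq_kj; case: (boolP (u \in rho k)) => [/(rho_disjoint uj) jk|_];
  rewrite ?mulr0 // jk eqxx in neq_kj *.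
Qed.

Lemma det_jump_mx (R : comPzRingType) :
  \det (jump_mx R) = 1 \/ \det (jump_mx R) = -1.
Proof.
have detH : \det (jump_mx R) = (\det (jump_mx int))%:~R.
  by rewrite -det_map_mx map_jump_mx.
have [det1|det1] : \det (jump_mx int) = 1 \/ \det (jump_mx int) = -1.
- by apply: unit_int_det_mod => p _; rewrite map_jump_mx det_jump_mx_neq0.
- by left; rewrite detH det1.
- by right; rewrite detH det1 rmorphN1.
Qed.

Lemma alexander_matrix_factor :
  alexander_matrix K rho =
  diag_mx (\row_i (xvar ^+ (sgnS K i == 1) * (dsign K i)%:~R)) *m
  ((1%:M + span_mx K *m (1%:M - XmS_mx K))^T *m
   (diag_mx (\row_i (dsign K i)%:~R) *m jump_mx laurent_frac)).
Proof.
apply/matrixP => i j; rewrite mul_diag_mx !mxE.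
transitivity (\sum_(s : bool) \sum_(a : bool)
    rho_ind laurent_frac j (corner_over K i s a) * marking s a).
  apply: eq_bigr => s _; rewrite big_mkcond; apply: eq_bigr => a _.
  by rewrite /rho_ind; case: ifP; rewrite ?mul1r ?mul0r.
rewrite alexander_row => [|u v adj_uv|s].
- congr (_ * _); apply: eq_bigr => k _; rewrite mul_diag_mx !mxE.
  by [].
- by rewrite /rho_ind (rho_adj adj_uv).
- by rewrite /rho_ind rho_ord0.
Qed.

(** Each d_i occurs in both diagonal factors and squares to 1, leaving one [xvar] per crossing with
    S = +1. *)
Lemma Delta_beta :
  Delta K rho = xvar ^+ num_S_pos K * beta K * \det (jump_mx laurent_frac).
Proof.
rewrite /Delta alexander_matrix_factor !det_mulmx !det_diag det_tr -/(beta K).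
rewrite (mulrCA (beta K)) !mulrA -big_split /=; congr (_ * _ * _).
rewrite (eq_bigr (fun i => if sgnS K i == 1 then xvar else 1)) => [|i _].
  by rewrite -big_mkcond prodr_const /num_S_pos cardsE.
rewrite !mxE -mulrA -intrM /dsign.
by case: ifP => _; case: eqP => _; rewrite ?mulr1.
Qed.

End Regions.

End Diagram.

Theorem theorem1 (n : nat) (K : long_diagram n)
    (rho : 'I_n -> {set arc_side n})
    (rho_inj : injective rho)
    (rho_regions : [set rho j | j : 'I_n] = bounded_regions K) :
  let l := num_S_pos K in
  beta K = xvar ^- l * Delta K rho \/ beta K = - (xvar ^- l * Delta K rho).
Proof.
move=> l; have x_neq0 : xvar != 0 by rewrite tofrac_eq0 polyX_eq0.
rewrite Delta_beta //.
have [] := det_jump_mx K rho_inj rho_regions laurent_frac => ->.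
  by left; rewrite mulr1 mulKf // expf_neq0.
by right; rewrite mulrN1 mulrN opprK mulKf // expf_neq0.
Qed.
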